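(* Assume that $\mathcal{G}$ is a bipartite graph with a matching saturating one of its color classes and $\mathcal{H}$ is an arbitrary graph. Then for sufficiently large $n$, $$R(\mathcal{G},n\mathcal{H})=n|V(\mathcal{H})|+\nu(\mathcal{G})-1.$$
   Context: A graph is a pair $(V,E)$ where $V$ is a set of vertices and $E$ is a set of $2$-subsets of $V$ (the edges). $n\mathcal{H}$ denotes $n$ disjoint copies of $\mathcal{H}$. A matching is a set of mutually disjoint edges, and the matching number $\nu(\mathcal{G})$ is the size of the largest matching in $\mathcal{G}$. The Ramsey number $R(\mathcal{G},\mathcal{H})$ is the smallest positive integer $N$ such that every red-blue coloring of the edges of the complete graph on $N$ vertices contains a red copy of $\mathcal{G}$ or a blue copy of $\mathcal{H}$.
   Formalization: H is assumed to have at least one vertex and, when ν(G) ≥ 2, no isolated vertex (for G = 2K_2, H = K_1 the Ramsey number is n, not n+1); both color classes of G are assumed nonempty, which excludes only edgeless G. *)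

(* Defs.v *)
From mathcomp Require Import all_boot.

Set Implicit Arguments.
Unset Strict Implicit.
Unset Printing Implicit Defensive.

Record graph := Graph {
  vertex :> finType;
  edges : {set {set vertex}};
  edges_card2 : forall e, e \in edges -> #|e| = 2
}.

Definition contains (K G : graph) : Prop :=
  exists f : G -> K,
    injective f /\ forall e : {set G}, e \in edges G -> f @: e \in edges K.

Section Copies.
Variables (n : nat) (H : graph).

Definition copies_edges : {set {set 'I_n * H}} :=
  [set pair i @: (e : {set H}) | i in 'I_n, e in edges H].

Lemma copies_card2 e : e \in copies_edges -> #|e| = 2.
Proof.
case/imset2P=> i e' _ /edges_card2 e2 ->.
by rewrite card_imset // => x y [].
Qed.

Definition copies : graph := Graph copies_card2.
End Copies.

Section ColourClass.
Variables (N : nat) (c : {set 'I_N} -> bool) (b : bool).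

Definition colour_edges : {set {set 'I_N}} :=
  [set e : {set 'I_N} | (#|e| == 2) && (c e == b)].

Lemma colour_card2 e : e \in colour_edges -> #|e| = 2.
Proof. by rewrite inE => /andP[/eqP]. Qed.

Definition colour_class : graph := Graph colour_card2.
End ColourClass.

(* [true] is red and [false] is blue; the edges of K_N are the 2-subsets of
   'I_N, and the values of [c] on other subsets play no role. *)
Definition arrows (N : nat) (G H : graph) : Prop :=
  forall c : {set 'I_N} -> bool,
    contains (colour_class c true) G \/ contains (colour_class c false) H.

Definition is_ramsey_number (G H : graph) (N : nat) : Prop :=
  [/\ 0 < N, arrows N G H & forall M, 0 < M -> arrows M G H -> N <= M].

Definition matching (G : graph) (M : {set {set G}}) : bool :=
  (M \subset edges G) && trivIset M.

Definition matching_number (G : graph) : nat :=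
  \max_(M : {set {set G}} | matching M) #|M|.

Definition independent (G : graph) (A : {set G}) : Prop :=
  forall e : {set G}, e \in edges G -> ~~ (e \subset A).

(* Colour classes are nonempty, as the blocks of a partition. Otherwise the
   empty matching would saturate an empty class of an edgeless graph. *)
Definition colour_classes (G : graph) (A B : {set G}) : Prop :=
  [/\ A != set0, B != set0, A :&: B = set0 & A :|: B = [set: G]]
  /\ independent A /\ independent B.

Definition saturates (G : graph) (M : {set {set G}}) (A : {set G}) : bool :=
  A \subset cover M.

Definition bipartite_with_saturating_matching (G : graph) : Prop :=
  exists A B : {set G}, colour_classes A B /\
    exists M : {set {set G}}, matching M /\ (saturates M A \/ saturates M B).

(* Isolated vertices of H matter: an unrestricted formula for R(G, nH) fails
   at G = 2K_2, H = K_1, where the Ramsey number is n and not n + 1. *)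
Definition no_isolated_vertex (H : graph) : Prop :=
  forall x : H, exists2 e : {set H}, e \in edges H & x \in e.

(* Main.v *)
Require Import Defs.
From mathcomp Require Import all_boot zify.

(* With A the saturated class, nu(G) = |A| and G lies in K_{a,b} for a = |A|,
   b = |B|.  Colouring red the edges that meet a fixed set of a - 1 vertices
   gives the lower bound, since that set covers every red matching.  For the
   upper bound, suppose there is no red K_{a,b}, and let m = |V(H)|.  By Ramsey's
   theorem there is a large blue clique K; at most a - 1 outside vertices have
   few blue neighbours in K.  Tile the other outside vertices greedily with blue
   copies of K_m: boundedly many are left over, and each of these is completed to
   a blue K_m by m - 1 vertices of K.  What remains of K is tiled up to fewer than
   m vertices.  So fewer than a + m of the nm + a - 1 vertices stay uncovered,
   which leaves room for at least n blue copies of K_m. *)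

Set Implicit Arguments.
Unset Strict Implicit.
Unset Printing Implicit Defensive.

(** * Subsets and injections of finite sets *)

Lemma subset_of_card (T : finType) (X : {set T}) k :
  k <= #|X| -> exists2 Y : {set T}, Y \subset X & #|Y| = k.
Proof.
case/card_geqP=> s [s_uniq <- sX]; exists [set x in s].
  by apply/subsetP=> x; rewrite inE; apply: sX.
by rewrite cardsE; apply/card_uniqP.
Qed.

(** Elements are matched by their position in the enumerations of [A] and [B]. The point [y0] is the
    default of [nth], needed because [g] is total on [S]. *)
Lemma exists_injection_in (S T : finType) (y0 : T) (A : {set S}) (B : {set T}) :
  #|A| <= #|B| ->
  exists2 g : S -> T, {in A &, injective g} & {in A, forall x, g x \in B}.
Proof.
move=> leAB; have idx x : x \in A -> index x (enum A) < size (enum B).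
  by move=> xA; rewrite -cardE (leq_trans _ leAB) // cardE index_mem mem_enum.
exists (fun x => nth y0 (enum B) (index x (enum A))) => [x y xA yA /eqP|x xA].
  rewrite nth_uniq ?idx ?enum_uniq // => /eqP eq_idx.
  by rewrite -(nth_index x (s := enum A) (x := x)) ?mem_enum // eq_idx
    nth_index ?mem_enum.
by rewrite -mem_enum mem_nth ?idx.
Qed.

(** * Cliques and Ramsey's theorem *)

Definition clique (T : finType) (e : rel T) (Y : {set T}) : Prop :=
  {in Y &, forall x y, x != y -> e x y}.

Lemma clique_sub (T : finType) (e : rel T) (Y Z : {set T}) :
  Z \subset Y -> clique e Y -> clique e Z.
Proof. by move=> /subsetP sZY cY x y /sZY xY /sZY; apply: cY. Qed.

Lemma cliqueU1 (T : finType) (e : rel T) (x : T) (Y : {set T}) :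
  symmetric e -> clique e Y -> {in Y, forall y, e x y} -> clique e (x |: Y).
Proof.
move=> esym cY xY u v; rewrite !inE.
case/predU1P=> [->|uY] /predU1P[->|vY]; rewrite ?eqxx // => neq.
- exact: xY.
- by rewrite esym xY.
- exact: cY.
Qed.

(** Induction on [s + t]: after removing a vertex [x], one of the two neighbourhoods of [x] has at
    least half the required size, and a clique found there either suffices or is extended by [x]. *)
Theorem ramsey (T : finType) (e : rel T) (s t : nat) (X : {set T}) :
  symmetric e -> 2 ^ (s + t) <= #|X| ->
  exists2 Y : {set T}, Y \subset X &
    (#|Y| = s /\ clique e Y) \/ (#|Y| = t /\ clique (fun x y => ~~ e x y) Y).
Proof.
move=> esym; have [k] := ubnP (s + t); elim: k => // k IHk in s t X *.
have clique0 f : clique f (set0 : {set T}) by move=> x y; rewrite inE.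
case: s => [|s]; first by exists set0; [exact: sub0set | left; rewrite cards0].
case: t => [|t]; first by exists set0; [exact: sub0set | right; rewrite cards0].
rewrite addSn ltnS => lek leX.
have /card_gt0P[x xX] : 0 < #|X| by rewrite (leq_trans _ leX) ?expn_gt0.
have := cardsD1 x X; rewrite xX -(cardsID [set y | e x y] (X :\ x)) => cardX.
have subX (Y : {set T}) : Y \subset X :\ x -> x |: Y \subset X.
  by move=> sY; rewrite subUset sub1set xX (subset_trans sY) ?subD1set.
have cardU (Y : {set T}) n : Y \subset X :\ x -> #|Y| = n -> #|x |: Y| = n.+1.
  by move=> sY <-; rewrite cardsU1 (contraNN (subsetP sY x)) ?inE ?eqxx.
have [le1|lt1] := leqP (2 ^ (s + t.+1)) #|(X :\ x) :&: [set y | e x y]|.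
  have [|Y sY] := IHk s t.+1 _ _ le1; first lia.
  have [sYX sYe] : Y \subset X :\ x /\ Y \subset [set y | e x y].
    by move: sY; rewrite subsetI => /andP.
  case=> -[cY qY]; last by exists Y; [exact: subset_trans (subD1set X x) | right].
  exists (x |: Y); [exact: subX | left; split; first exact: cardU].
  by apply: cliqueU1 => // y /(subsetP sYe); rewrite inE.
have [||Y sY] := IHk s.+1 t ((X :\ x) :\: [set y | e x y]); first lia.
  (* With p = 2^(s+t+1), removing [x] and fewer than p neighbours from at least 2p vertices leaves
     at least p. *)
  move: leX; rewrite expnS addSnnS; lia.
have [sYX sYe] : Y \subset X :\ x /\ [disjoint Y & [set y | e x y]].
  by move: sY; rewrite subsetD => /andP.
case=> -[cY qY]; first by exists Y; [exact: subset_trans (subD1set X x) | left].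
exists (x |: Y); [exact: subX | right; split; first exact: cardU].
apply: cliqueU1 => // [u v|y yY]; first by rewrite esym.
by have := disjointFr sYe yY; rewrite inE => ->.
Qed.

(** * Tilings by cliques of equal size *)

Definition tiled (T : finType) (e : rel T) (m : nat) (X : {set T}) : Prop :=
  exists P : {set {set T}},
    [/\ cover P = X, trivIset P & {in P, forall B : {set T}, #|B| = m /\ clique e B}].

Lemma tiled0 (T : finType) (e : rel T) m : tiled e m set0.
Proof.
exists set0; split; first by rewrite /cover big_set0.
  by apply/trivIsetP=> A B; rewrite inE.
by move=> B; rewrite inE.
Qed.

Lemma tiled1 (T : finType) (e : rel T) (B : {set T}) :
  clique e B -> tiled e #|B| B.
Proof.
move=> cB; exists [set B]; split; first by rewrite /cover big_set1.
  by apply/trivIsetP=> A C; rewrite !inE => /eqP-> /eqP->; rewrite eqxx.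
by move=> C; rewrite inE => /eqP->.
Qed.

Lemma tiledU (T : finType) (e : rel T) m (X Y : {set T}) :
  [disjoint X & Y] -> tiled e m X -> tiled e m Y -> tiled e m (X :|: Y).
Proof.
move=> dXY [P [cP tP uP]] [Q [cQ tQ uQ]]; exists (P :|: Q); split.
- by rewrite /cover bigcup_setU -/(cover P) -/(cover Q) cP cQ.
- by apply: trivIsetU => //; rewrite cP cQ.
- by move=> B; rewrite inE => /orP[/uP|/uQ].
Qed.

Lemma greedy_tiling (T : finType) (e : rel T) m r (X : {set T}) : 0 < m ->
  (forall Y : {set T}, Y \subset X -> r <= #|Y| ->
     exists B : {set T}, [/\ B \subset Y, #|B| = m & clique e B]) ->
  exists Z : {set T}, [/\ Z \subset X, tiled e m Z & #|X :\: Z| < r].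
Proof.
move=> m_gt0; have [k] := ubnP #|X|; elim: k => // k IHk in X * => ltXk tileX.
have [ltXr|leX] := ltnP #|X| r.
  by exists set0; rewrite sub0set setD0; split=> //; apply: tiled0.
have [B [sBX cardB cB]] := tileX X (subxx X) leX.
have := cardsDS sBX => cardD; have leB := subset_leq_card sBX.
have [||Z [sZ tZ ltZ]] := IHk (X :\: B); first lia.
  by move=> Y sY; apply: tileX; apply: subset_trans (subsetDl X B).
exists (B :|: Z); rewrite subUset sBX (subset_trans sZ) ?subsetDl //= -setDDl.
split=> //; apply: tiledU => //; last by rewrite -cardB; apply: tiled1.
by move: sZ; rewrite subsetD disjoint_sym => /andP[].
Qed.

(** Each [u] takes [m.-1] of its neighbours in the clique [K]. This costs every other vertex of [U]
    at most [m.-1] neighbours while [U] loses one element, so the degree hypothesis survives the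
    induction. *)
Lemma absorb (T : finType) (e : rel T) m (U K : {set T}) : 0 < m ->
  symmetric e -> clique e K -> [disjoint U & K] ->
  {in U, forall u, #|U| * m.-1 <= #|K :&: [set v | e u v]|} ->
  exists2 Z : {set T}, Z \subset K & tiled e m (U :|: Z).
Proof.
move=> m_gt0 esym; have [k] := ubnP #|U|; elim: k => // k IHk in U K *.
move=> ltUk cK dUK nbrU; have [->|[u uU]] := set_0Vmem U.
  by exists set0; rewrite ?sub0set // setU0; apply: tiled0.
have cardU := cardsD1 u U; rewrite uU add1n in cardU.
have [|B sB cardB] := @subset_of_card _ (K :&: [set v | e u v]) m.-1.
  by apply: leq_trans (nbrU u uU); rewrite cardU leq_pmull.
have [sBK sBu] : B \subset K /\ B \subset [set v | e u v].
  by move: sB; rewrite subsetI => /andP.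
have [||||Z sZ tZ] := IHk (U :\ u) (K :\: B).
- lia.
- exact: clique_sub (subsetDl K B) cK.
- by apply: disjointWl (subD1set U u) _; apply: disjointWr (subsetDl K B) dUK.
- move=> v /setD1P[_ vU]; rewrite setIDAC (cardsD _ B).
  have := nbrU v vU; have := subset_leq_card (subsetIr (K :&: [set w | e v w]) B).
  rewrite cardU mulSn cardB; lia.
have uK := disjointFr dUK uU.
have [sZK dZB] : Z \subset K /\ [disjoint Z & B] by move: sZ; rewrite subsetD => /andP.
exists (B :|: Z); first by rewrite subUset sBK.
have -> : U :|: (B :|: Z) = (u |: B) :|: ((U :\ u) :|: Z).
  by rewrite -{1}(setD1K uU) setUACA.
apply: tiledU => //.
  apply/pred0P=> x /=; apply/negP=> /andP[]; rewrite !inE.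
  case/predU1P=> [->|xB]; first by rewrite eqxx /= => /(subsetP sZK); rewrite uK.
  case/orP=> [/andP[_ xU]|xZ].
    by have := subsetP sBK x xB; rewrite (disjointFr dUK).
  by rewrite (disjointFr dZB) in xB.
have <- : #|u |: B| = m.
  by rewrite cardsU1 cardB (contraFN (subsetP sBK u)) // add1n prednK.
apply/tiled1/cliqueU1 => //; first exact: clique_sub cK.
by move=> v /(subsetP sBu); rewrite inE.
Qed.

(** * The dichotomy: a red biclique or many disjoint blue cliques *)

(** The constant [r] is the Ramsey threshold for a red clique of size [a + b], which contains the
    biclique, or a blue one of size [m]. Thus fewer than [r] vertices are left to absorb, and
    [r * m.-1] blue neighbours suffice for each. [L] leaves [b] vertices of [K] after the blue
    neighbours of [a] poorly connected vertices are deleted. *)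
Lemma biclique_or_tiles (T : finType) (red : rel T) (a b m n : nat) :
  symmetric red -> 0 < a -> 0 < m ->
  let blue := fun x y => ~~ red x y in
  let r := 2 ^ (a + b + m) in
  let L := b + a * (r * m.-1) in
  2 ^ (a + b + L) <= #|T| -> #|T| = n * m + a - 1 ->
  (exists X Y : {set T}, [/\ #|X| = a, #|Y| = b, [disjoint X & Y] &
      {in X & Y, forall x y, red x y}]) \/
  (exists P : {set {set T}}, [/\ n <= #|P|, trivIset P &
      {in P, forall B : {set T}, #|B| = m /\ clique blue B}]).
Proof.
move=> rsym a_gt0 m_gt0 blue r L leT cardT.
have bsym : symmetric blue by move=> x y; rewrite /blue rsym.
pose biclique := exists X Y : {set T}, [/\ #|X| = a, #|Y| = b, [disjoint X & Y] &
      {in X & Y, forall x y, red x y}].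
have redclique (Y : {set T}) : #|Y| = a + b -> clique red Y -> biclique.
  move=> cardY cY; have [|X sXY cardX] := @subset_of_card _ Y a; first lia.
  exists X, (Y :\: X); split=> //; first by rewrite cardsDS // cardY cardX addKn.
    by rewrite -setI_eq0 setIDA setDIl setDv set0I.
  move=> x y xX /setDP[yY yX]; apply: cY => //; first exact: subsetP xX.
  by apply: contraNneq yX => <-.
have [K _ [[cardK cK]|[cardK cK]]] :=
  @ramsey T red (a + b) L setT rsym (leq_trans leT (eq_leq (esym (cardsT T)))).
  by left; apply: (redclique K).
(* Any [a] members of [S] are jointly red to all but [a * c] vertices of [K],
   hence to [b] of them, so [S] has fewer than [a] members. *)
pose c := r * m.-1; pose nbr v := K :&: [set w | blue v w].
pose S := [set v | (v \notin K) && (#|nbr v| < c)].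
have [leS|ltS] := leqP a #|S|.
  left; have [X sXS cardX] := subset_of_card leS.
  have leU : #|\bigcup_(v in X) nbr v| <= a * c.
    rewrite -cardX -sum_nat_const; elim/big_rec2: _ => [|v s A vX leA].
      by rewrite cards0.
    have /andP[_ ltv] : (v \notin K) && (#|nbr v| < c).
      by have := subsetP sXS v vX; rewrite inE.
    by rewrite (leq_trans (leq_card_setU _ _)) // leq_add // ltnW.
  have [|Y sY cardY] := @subset_of_card _ (K :\: \bigcup_(v in X) nbr v) b.
    have := subset_leq_card (subsetIr K (\bigcup_(v in X) nbr v)).
    by rewrite cardsD cardK /L -/c; lia.
  exists X, Y; split=> //.
    apply/pred0P=> v /=; apply/negP=> /andP[/(subsetP sXS)]; rewrite inE => /andP[vK _].
    by move/(subsetP sY); rewrite inE (negPf vK) andbF.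
  move=> x y xX /(subsetP sY) /setDP[yK]; apply: contraNT => nxy.
  by apply/bigcupP; exists x => //; rewrite !inE yK.
(* The greedy tiling needs a blue clique in every large subset, so the existence of a red clique is
   decided globally first. *)
have [ex|no_ex] := boolP [exists B : {set T}, (#|B| == a + b) &&
    [forall x in B, forall y in B, (x != y) ==> red x y]].
  left; case/existsP: ex => B /andP[/eqP cardB /forall_inP cB].
  by apply: (redclique B) => // x y /cB/forall_inP h /h/implyP.
right.
have [|T1 [sT1 tT1 ltU]] := @greedy_tiling T blue m r (~: (S :|: K)) m_gt0.
  move=> Y _ leY; have [B sBY [[cardB cB]|[cardB cB]]] := ramsey rsym leY.
    case/negP: no_ex; apply/existsP; exists B; rewrite cardB eqxx /=.
    by apply/forall_inP=> x xB; apply/forall_inP=> y yB; apply/implyP; apply: cB.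
  by exists B.
set U := _ :\: T1 in ltU.
have UP v : v \in U -> (v \notin K) && (c <= #|nbr v|).
  rewrite !inE negb_or negb_and negbK -leqNgt => /andP[_ /andP[/orP[]->]] //.
  by move->; rewrite ?andbT.
have dUK : [disjoint U & K].
  by apply/pred0P=> v /=; apply/negP=> /andP[/UP/andP[/negP]].
have [|Z sZK tUZ] := @absorb T blue m U K m_gt0 bsym cK dUK.
  move=> u /UP/andP[_]; apply: leq_trans; by rewrite leq_mul2r (ltnW ltU) orbT.
(* Any [m] vertices of [K] form a blue clique, so here the greedy threshold is [m] itself. *)
have [|T2 [sT2 tT2 ltR]] := @greedy_tiling T blue m m (K :\: Z) m_gt0.
  move=> Y sY leY; have [B sBY cardB] := subset_of_card leY; exists B; split=> //.
  by apply: clique_sub cK; rewrite (subset_trans sBY) // (subset_trans sY) ?subsetDl.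
set R := _ :\: T2 in ltR.
have [sT2K dZT2] : T2 \subset K /\ [disjoint T2 & Z]
  by move: sT2; rewrite subsetD => /andP.
have T1K v : v \in T1 -> v \notin K.
  by move/(subsetP sT1); rewrite !inE negb_or => /andP[].
have dT1 : [disjoint T1 & U :|: Z :|: T2].
  apply/pred0P=> v /=; apply/negP=> /andP[vT1].
  rewrite inE in_setU !inE vT1 /= => /orP[/(subsetP sZK)|/(subsetP sT2K)]; exact/negP/T1K.
have dUZ : [disjoint U :|: Z & T2].
  by rewrite disjoints_subset subUset -!disjoints_subset (disjointWr sT2K dUK) disjoint_sym.
have [P [cP tP uP]] := tiledU dT1 tT1 (tiledU dUZ tUZ tT2).
exists P; split=> //.
have cardW : #|cover P| = #|P| * m.
  by rewrite -(eqnP tP) -sum_nat_const; apply: eq_bigr => B /uP[].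
have covT : #|T| <= #|S| + (#|P| * m + #|R|).
  rewrite -cardW -cardsT cP.
  apply: leq_trans (leq_add (leqnn _) (leq_card_setU _ _)).
  apply: leq_trans (leq_card_setU _ _); apply/subset_leq_card/subsetP=> v _.
  rewrite !inE.
  by case: (_ < c); case: (v \in K); case: (v \in T1); case: (v \in Z); case: (v \in T2); rewrite ?orbT ?andbT.
(* From nm + a - 1 <= (a - 1) + m|P| + (m - 1) follows nm < (|P| + 1)m. *)
rewrite -ltnS -(ltn_pmul2r m_gt0) mulSn; lia.
Qed.

(** * Matching number, vertex covers and the saturated class *)

(** Choosing in each matching edge a vertex of [C] is injective, since the edges are disjoint. *)
Lemma matching_number_le_cover (G : graph) (C : {set G}) :
  {in edges G, forall e : {set G}, e :&: C != set0} -> matching_number G <= #|C|.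
Proof.
move=> covC; apply/bigmax_leqP=> M /andP[/subsetP sM tM].
(* Values in [option G] spare a default vertex. *)
have [f fP] : exists f : {set G} -> option G,
    forall e, e \in M -> exists2 x, f e = Some x & x \in e :&: C.
  exists (fun e : {set G} => [pick x in e :&: C]) => e /sM/covC/set0Pn[x xe].
  by case: pickP => [y ye|/(_ x)]; [exists y | rewrite xe].
have inj_f : {in M &, injective f}.
  move=> e e' eM e'M eq_f; have [x fx /setIP[xe _]] := fP e eM.
  have [y fy /setIP[ye' _]] := fP e' e'M.
  have eq_xy : x = y by move: eq_f; rewrite fx fy => -[].
  by rewrite -(def_pblock tM eM xe) -(def_pblock tM e'M ye') eq_xy.
rewrite -(card_in_imset inj_f) -(card_imset (mem C) Some_inj).
apply/subset_leq_card/subsetP=> _ /imsetP[e eM ->].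
by have [x -> /setIP[_ xC]] := fP e eM; apply: imset_f.
Qed.

Lemma edge_between (G : graph) (A B e : {set G}) :
  A :|: B = setT -> independent A -> independent B -> e \in edges G ->
  exists x y, [/\ x \in A, y \in B & e = [set x; y]].
Proof.
move=> AB iA iB eG; have /eqP/cards2P[x [y [_ De]]] := edges_card2 eG.
have := iA e eG; have := iB e eG; rewrite De !subUset !sub1set.
have : x \in A :|: B by rewrite AB inE.
have : y \in A :|: B by rewrite AB inE.
rewrite !inE => /orP[yA|yB] /orP[xA|xB]; rewrite ?xA ?yA ?xB ?yB ?andbT //=.
- by move=> xnB; exists y, x; rewrite setUC.
- by exists x, y.
Qed.

(** The class [A] meets every edge, which bounds the matching number above. Conversely, no edge
    holds two vertices of [A], so sending each vertex of [A] to its matching edge is injective. *)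
Lemma matching_number_saturated (G : graph) (A B : {set G}) (M : {set {set G}}) :
  A :|: B = setT -> independent A -> independent B ->
  matching M -> saturates M A -> matching_number G = #|A|.
Proof.
move=> AB iA iB mM satA; apply/eqP; rewrite eqn_leq; apply/andP; split.
  apply: matching_number_le_cover => e eG.
  have [x [y [xA yB ->]]] := edge_between AB iA iB eG.
  by apply/set0Pn; exists x; rewrite !inE eqxx.
have /andP[/subsetP sM tM] := mM.
rewrite /matching_number (bigmax_sup M) //.
have inj : {in A &, injective (pblock M)}.
  move=> x x' xA x'A eq_b; have eM := pblock_mem (subsetP satA x xA).
  have [u [v [uA vB De]]] := edge_between AB iA iB (sM _ eM).
  have : x \in pblock M x by rewrite mem_pblock (subsetP satA).
  have : x' \in pblock M x by rewrite eq_b mem_pblock (subsetP satA).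
  have vA : v \notin A.
    apply: contra (iA _ (sM _ eM)) => vA; by rewrite De subUset !sub1set uA.
  have neq z : z \in A -> z != v by apply: contraTneq => ->.
  by rewrite De !inE (negPf (neq _ xA)) (negPf (neq _ x'A)) !orbF => /eqP-> /eqP->.
rewrite -(card_in_imset inj); apply/subset_leq_card/subsetP=> _ /imsetP[x xA ->].
by apply: pblock_mem; apply: subsetP xA.
Qed.

(** * Monochromatic copies from bicliques and disjoint cliques *)

Lemma contains_bipartite N (c : {set 'I_N} -> bool) (G : graph) (A B : {set G})
    (X Y : {set 'I_N}) :
  A != set0 -> A :&: B = set0 -> A :|: B = setT -> independent A -> independent B ->
  #|A| = #|X| -> #|B| = #|Y| -> [disjoint X & Y] ->
  {in X & Y, forall x y, c [set x; y]} -> contains (colour_class c true) G.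
Proof.
move=> A0 AB0 AB iA iB cardA cardB dXY cXY.
have [y0 _] : exists y0, y0 \in X by apply/card_gt0P; rewrite -cardA card_gt0.
have [g gI gX] := exists_injection_in y0 (eq_leq cardA).
have [h hI hY] := exists_injection_in y0 (eq_leq cardB).
pose f (x : G) := if x \in A then g x else h x.
have inB x : x \notin A -> x \in B.
  by move/negPf=> xA; have := in_setT x; rewrite -AB inE xA.
have notA x : x \in B -> x \notin A.
  by move=> xB; apply/negP=> xA; have := in_set0 x; rewrite -AB0 inE xA xB.
have neq x y : x \in X -> y \in Y -> x != y.
  by move=> xX; apply: contraTneq => <-; rewrite (disjointFr dXY).
exists f; split=> [x y|e eG].
  rewrite /f; case: ifPn => xA; case: ifPn => yA.
  - exact: gI.
  - by move/eqP; rewrite (negPf (neq _ _ (gX x xA) (hY y (inB y yA)))).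
  - by move/eqP; rewrite eq_sym (negPf (neq _ _ (gX y yA) (hY x (inB x xA)))).
  - by apply: hI; apply: inB.
have [x [y [xA yB ->]]] := edge_between AB iA iB eG.
rewrite imsetU1 imset_set1 /f xA (negPf (notA y yB)) inE cards2.
by rewrite neq ?gX ?hY //= cXY ?gX ?hY.
Qed.

Lemma contains_copies N (c : {set 'I_N} -> bool) (H : graph) n
    (P : {set {set 'I_N}}) :
  0 < #|H| -> n <= #|P| -> trivIset P ->
  {in P, forall B : {set 'I_N},
     #|B| = #|H| /\ clique (fun x y => ~~ c [set x; y]) B} ->
  contains (colour_class c false) (copies n H).
Proof.
move=> H_gt0 leP tP uP.
pose Q (i : 'I_n) := enum_val (widen_ord leP i).
have QP i : Q i \in P by apply: enum_valP.
have QI : injective Q by move=> i j /enum_val_inj/(congr1 val) eq_ij; apply: val_inj.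
have /fin_all_exists[g gP] i : exists g : H -> 'I_N,
    injective g /\ forall x, g x \in Q i.
  have [cardQ _] := uP _ (QP i).
  have [y0 _] : exists y0, y0 \in Q i by apply/card_gt0P; rewrite cardQ.
  have [|g gI gQ] := @exists_injection_in H _ y0 setT (Q i).
    by rewrite cardsT cardQ.
  by exists g; split=> [x y|x]; [apply: gI | apply: gQ]; rewrite inE.
exists (fun u => g u.1 u.2); split=> [[i x] [j y] /= eq_g|e].
  (* The blocks are disjoint, so an image vertex determines its block and hence the index of its
     copy. *)
  have eq_ij : i = j.
    apply/QI; rewrite -(def_pblock tP (QP i) ((gP i).2 x)) eq_g.
    exact: def_pblock (QP j) ((gP j).2 y).
  by case: j / eq_ij in eq_g *; rewrite ((gP i).1 _ _ eq_g).
case/imset2P=> i e' _ e'H ->; have /eqP/cards2P[x [y [neq_xy ->]]] := edges_card2 e'H.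
rewrite !(imsetU1, imset_set1) /= inE cards2.
have neq_g : g i x != g i y by apply: contraNneq neq_xy => /(gP i).1->.
rewrite neq_g /= eqbF_neg; apply: (uP _ (QP i)).2 => //; exact: (gP i).2.
Qed.

(** * The two bounds on the Ramsey number *)

Lemma arrows_upper (G H : graph) (A B : {set G}) n :
  0 < #|H| -> A != set0 -> A :&: B = set0 -> A :|: B = setT ->
  independent A -> independent B ->
  2 ^ (#|A| + #|B| + (#|B| + #|A| * (2 ^ (#|A| + #|B| + #|H|) * #|H|.-1)))
    <= n * #|H| + #|A| - 1 ->
  arrows (n * #|H| + #|A| - 1) G (copies n H).
Proof.
move=> H_gt0 A0 AB0 AB iA iB len c.
have csym : symmetric (fun x y => c [set x; y]) by move=> x y; rewrite setUC.
have A_gt0 : 0 < #|A| by rewrite card_gt0.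
have := @biclique_or_tiles _ _ #|A| #|B| #|H| n csym A_gt0 H_gt0.
rewrite card_ord => /(_ len erefl) [[X [Y [cX cY dXY cXY]]]|[P [leP tP uP]]].
  by left; apply: (@contains_bipartite _ c G A B X Y).
by right; apply: (@contains_copies _ c H n P).
Qed.

(** Edges meeting [S] are red. In a red copy of [G] the preimage of [S] is a vertex cover, too small
    for the matching number; a blue copy of nH must avoid [S], so n|H| <= M - |S|. *)
Lemma arrows_lower (G H : graph) n M :
  0 < n * #|H| -> 0 < matching_number G ->
  (1 < matching_number G -> no_isolated_vertex H) ->
  arrows M G (copies n H) -> n * #|H| + matching_number G - 1 <= M.
Proof.
set a := matching_number G => nH_gt0 a_gt0 hiso arr.
(* The minimum covers the case of [M] below [a.-1]: then [S] is everything and no vertex remains for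
   a blue copy. *)
have [|S _ cardS] := @subset_of_card _ [set: 'I_M] (minn a.-1 M).
  by rewrite cardsT card_ord geq_minr.
have [[f [fI fE]]|[g [gI gE]]] := arr (fun e => e :&: S != set0).
  have : a <= #|f @^-1: S|.
    apply: matching_number_le_cover => e /fE; rewrite inE => /andP[_ /eqP/set0Pn[y]].
    by case/setIP=> /imsetP[x xe ->{y}] fxS; apply/set0Pn; exists x; rewrite !inE xe.
  rewrite -(card_imset _ fI).
  have /subset_leq_card : f @: (f @^-1: S) \subset S.
    by apply/subsetP=> _ /imsetP[x + ->]; rewrite inE.
  rewrite cardS; lia.
have : [set g u | u in [set: 'I_n * H]] \subset ~: S.
  apply/subsetP=> _ /imsetP[[i x] _ ->]; rewrite inE; apply/negP=> gS.
  (* For [a] at most 1 the set [S] is empty; otherwise [x] lies on an edge of [H], whose blue image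
     cannot meet [S]. *)
  have [a_le1|/hiso isoH] := leqP a 1.
    have S0 : S = set0 by apply: cards0_eq; rewrite cardS; lia.
    by rewrite S0 inE in gS.
  have [e eH xe] := isoH x.
  have /gE : pair i @: e \in edges (copies n H) by apply: imset2_f.
  rewrite inE => /andP[_ /eqP/negbFE/eqP gS0].
  have := in_set0 (g (i, x)); rewrite -gS0 inE gS andbT.
  by rewrite !imset_f.
move/subset_leq_card; rewrite card_imset // cardsT card_prod card_ord.
have := cardsC S; rewrite card_ord cardS => cardC leC.
have {}leC : n * #|H| <= #|~: S| := leC.
lia.
Qed.

Theorem theorem2p10 (G H : graph)
    (hG : bipartite_with_saturating_matching G)
    (hH : 0 < #|H|)
    (hiso : 1 < matching_number G -> no_isolated_vertex H) :
  exists n0 : nat, forall n : nat, n0 <= n ->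
    is_ramsey_number G (copies n H) (n * #|H| + matching_number G - 1).
Proof.
(* The classes are swapped if necessary so that [A] is the saturated one. *)
have [A [B [A0 AB0 AB iA [iB aA]]]] : exists A B : {set G},
    [/\ A != set0, A :&: B = set0, A :|: B = setT, independent A &
        independent B /\ matching_number G = #|A|].
  have [A [B [[[A0 B0 AB0 AB] [iA iB]] [M [mM [sA|sB]]]]]] := hG.
    by exists A, B; split=> //; split=> //; apply: (matching_number_saturated AB iA iB mM sA).
  rewrite setUC in AB; rewrite setIC in AB0.
  by exists B, A; split=> //; split=> //; apply: (matching_number_saturated AB iB iA mM sB).
have A_gt0 : 0 < #|A| by rewrite card_gt0.
set K := 2 ^ (#|A| + #|B| + (#|B| + #|A| * (2 ^ (#|A| + #|B| + #|H|) * #|H|.-1))).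
(* Since n <= n|H|, the threshold [K] of the upper bound is reached; the successor makes [n]
   positive. *)
exists K.+1 => n ltKn; have lenH : n <= n * #|H| by apply: leq_pmulr.
split; first by lia.
  by rewrite aA; apply: (@arrows_upper G H A B) => //; rewrite -/K; lia.
by move=> M _; apply: arrows_lower => //; lia.
Qed.
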